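(* Let $X$ be a totally disconnected, compact, metrizable topological space. Let $\mathcal{G}\subset\mathrm{Homeo}(X)$ be an ample group that acts minimally on $X$. Suppose $H$ is a maximal subgroup of $\mathcal{G}$ that does not act minimally on $X$. Then $H=\mathrm{St}_{\mathcal{G}}(Y)$ for some closed set $Y\subset X$ different from the empty set and $X$. Moreover, the induced action of $\mathrm{St}_{\mathcal{G}}(Y)$ on $Y$ is minimal.
   Context: $\mathrm{Homeo}(X)$ is the group of all homeomorphisms of $X$. For a group $G\subset\mathrm{Homeo}(X)$, its full amplification $\mathsf{F}(G)$ is the group of all homeomorphisms $f$ of $X$ such that every point $x\in X$ has an open neighborhood $U_x$ on which $f$ coincides with some element of $G$. The group $G$ is called ample if $\mathsf{F}(G)=G$. A group acting by homeomorphisms on a space acts minimally if the only closed invariant subsets are the empty set and the whole space. For $Y\subset X$, the stabilizer is $\mathrm{St}_{\mathcal{G}}(Y)=\{g\in\mathcal{G}\mid g(Y)=Y\}$; its induced action on $Y$ is by restriction. A maximal subgroup of $\mathcal{G}$ is a proper subgroup $H$ such that there is no subgroup $K$ with $H\subsetneq K\subsetneq\mathcal{G}$. *)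

(* Defs.v *)
From HB Require Import structures.
From mathcomp Require Import all_boot all_order all_algebra.
From mathcomp Require Import all_classical all_reals topology.

Set Implicit Arguments.
Unset Strict Implicit.
Unset Printing Implicit Defensive.

Local Open Scope classical_set_scope.

Definition homeomorphism (T U : topologicalType) (f : T -> U) : Prop :=
  continuous f /\ exists g : U -> T, [/\ cancel f g, cancel g f & continuous g].

Definition metrizable (R : realType) (T : topologicalType) : Prop :=
  exists (M : metricType R) (f : T -> M), homeomorphism f.

Record homeo (X : topologicalType) := Homeo {
  homeo_fun :> X -> X;
  homeo_funP : `[< homeomorphism homeo_fun >] }.

HB.instance Definition _ (X : topologicalType) :=
  [isSub for @homeo_fun X].
HB.instance Definition _ (X : topologicalType) :=
  [Choice of homeo X by <:].

Section homeo_group.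
Variable X : topologicalType.
Implicit Types f g h : homeo X.

Lemma homeo_eqP f g : (f : X -> X) =1 g -> f = g.
Proof. by move=> fg; apply/val_inj/funext. Qed.

Lemma homeo1_subproof : `[< homeomorphism (@id X) >].
Proof.
by apply/asboolP; split; [move=> ?|exists id; split => // ?]; exact: cvg_id.
Qed.

Lemma homeoM_subproof f g : `[< homeomorphism (f \o g) >].
Proof.
have /asboolP [cf [f' [fK f'K cf']]] := homeo_funP f.
have /asboolP [cg [g' [gK g'K cg']]] := homeo_funP g.
apply/asboolP; split.
  by move=> x; apply: continuous_comp; [exact: cg|exact: cf].
exists (g' \o f'); split.
- exact: can_comp.
- exact: can_comp.
- by move=> x; apply: continuous_comp; [exact: cf'|exact: cg'].
Qed.

Definition homeo_inv_fun f : X -> X :=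
  projT1 (cid (proj2 (asboolW (homeo_funP f)))).

Lemma homeoK f : cancel f (homeo_inv_fun f).
Proof. by rewrite /homeo_inv_fun; case: cid => g []. Qed.

Lemma homeoVK f : cancel (homeo_inv_fun f) f.
Proof. by rewrite /homeo_inv_fun; case: cid => g []. Qed.

Lemma homeoV_subproof f : `[< homeomorphism (homeo_inv_fun f) >].
Proof.
apply/asboolP; split; first by rewrite /homeo_inv_fun; case: cid => g [].
exists f; split; [exact: homeoVK|exact: homeoK|].
by have /asboolP[] := homeo_funP f.
Qed.

Definition homeo_one : homeo X := Homeo homeo1_subproof.
Definition homeo_mul f g : homeo X := Homeo (homeoM_subproof f g).
Definition homeo_inv f : homeo X := Homeo (homeoV_subproof f).

Lemma homeo_mulA : associative homeo_mul.
Proof. by move=> f g h; exact: homeo_eqP. Qed.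

Lemma homeo_mul1 : left_id homeo_one homeo_mul.
Proof. by move=> f; exact: homeo_eqP. Qed.

Lemma homeo_mulr1 : right_id homeo_one homeo_mul.
Proof. by move=> f; exact: homeo_eqP. Qed.

Lemma homeo_mulV : left_inverse homeo_one homeo_inv homeo_mul.
Proof. by move=> f; apply: homeo_eqP => x /=; rewrite homeoK. Qed.

Lemma homeo_mulrV : right_inverse homeo_one homeo_inv homeo_mul.
Proof. by move=> f; apply: homeo_eqP => x /=; rewrite homeoVK. Qed.

End homeo_group.

HB.instance Definition _ (X : topologicalType) := isGroup.Build (homeo X)
  (@homeo_mulA X) (@homeo_mul1 X) (@homeo_mulr1 X)
  (@homeo_mulV X) (@homeo_mulrV X).

Definition subgroup (gT : groupType) (G : set gT) : Prop :=
  group_closed [in G].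

Definition maximal_subgroup (gT : groupType) (H G : set gT) : Prop :=
  [/\ subgroup H, H `<` G &
      ~ exists K : set gT, [/\ subgroup K, H `<` K & K `<` G]].

Section homeo_actions.
Variable X : topologicalType.
Implicit Types (G : set (homeo X)) (Y : set X).

Definition full_amplification G : set (homeo X) :=
  [set f : homeo X | forall x : X, exists U : set X, [/\ open U, U x &
     exists2 g, G g & forall y, U y -> f y = g y]].

Definition ample G : Prop := full_amplification G = G.

Definition acts_minimally G : Prop :=
  forall C : set X, closed C -> (forall g, G g -> g @` C = C) ->
    C = set0 \/ C = [set: X].

Definition stabilizer G Y : set (homeo X) :=
  [set g : homeo X | G g /\ g @` Y = Y].

(* The homeomorphisms of Y, with the subspace topology, that are restrictions
   of elements of G.  When every element of G maps Y onto itself, as is the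
   case for G = stabilizer G' Y, this is the image of the morphism
   G -> Homeo(Y) given by restriction. *)
Definition induced_action G Y : set (homeo (set_type Y)) :=
  [set h : homeo (set_type Y) | exists2 g, G g &
     forall y : set_type Y, \val (h y) = g (\val y)].

End homeo_actions.

Arguments induced_action {X} G Y _.

(* Main.v *)
Require Import Defs.
From mathcomp Require Import all_boot all_order all_algebra.
From mathcomp Require Import all_classical all_reals topology.

Local Open Scope classical_set_scope.

(** By compactness and Zorn's lemma, [H] has a minimal nonempty closed invariant
    set [Y].  It is not all of [X], as [H] does not act minimally.  Then [H] is
    contained in the stabilizer of [Y], which is a proper subgroup of [G] since
    [G] acts minimally, so maximality of [H] makes the two equal.  A closed
    subset of [Y] invariant under the induced action is closed in [X] and
    [H]-invariant, hence trivial by the choice of [Y]. *)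

(** The pointwise form, due to bijectivity, passes easily to inverses, products and complements. *)
Lemma homeo_imageP (X : topologicalType) (g : homeo X) (C : set X) :
  g @` C = C <-> forall x, C (g x) <-> C x.
Proof.
split=> [gC x|gC].
  split=> [|Cx]; last by rewrite -gC; exists x.
  by rewrite -{1}gC => -[y Cy /(can_inj (homeoK g)) <-].
apply/seteqP; split=> [_ [x Cx <-]|x Cx]; first exact/gC.
by exists (homeo_inv g x); rewrite /= ?homeoVK//; apply/gC; rewrite homeoVK.
Qed.

(** Both [g] and its inverse preserve [Y], and their restrictions are continuous and mutually
    inverse. This supplies elements of [induced_action]. *)
Lemma homeo_restrict (X : topologicalType) (g : homeo X) (Y : set X) :
  g @` Y = Y ->
  exists h : homeo Y, forall y : Y, \val (h y) = g (\val y).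
Proof.
have restr (f : homeo X) : (forall x, Y x -> Y (f x)) ->
    exists2 h : Y -> Y, continuous h & forall y, \val (h y) = f (\val y).
  move=> fY; have fYP (y : Y) : f (\val y) \in Y.
    by apply/mem_set/fY/set_mem/valP.
  exists (fun y => SigSub (fYP y)) => //.
  apply: (@continuous_comp_initial _ _ _ set_val) => x.
  apply: (@continuous_comp _ _ _ set_val f); first exact: initial_continuous.
  by have /asboolP[+ _] := homeo_funP f; apply.
move=> /homeo_imageP gY.
have [x /gY//|h ch hE] := restr g.
have [|k ck kE] := restr (homeo_inv g).
  by move=> x Yx; apply/gY; rewrite /= homeoVK.
have hP : `[< homeomorphism h >].
  apply/asboolP; split=> //; exists k; split=> // y; apply: val_inj.
    by rewrite kE hE /= homeoK.
  by rewrite hE kE /= homeoVK.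
by exists (Homeo hP).
Qed.

Lemma closed_set_val_image (X : topologicalType) (Y : set X) (C : set Y) :
  closed Y -> closed C -> closed (set_val @` C).
Proof.
move=> cY; rewrite -openC => -[B oB BC].
suff -> : set_val @` C = Y `&` ~` B by apply: closedI => //; exact: open_closedC.
apply/seteqP; split=> [_ [y Cy <-]|x [Yx nBx]].
  split; first exact/set_mem/valP.
  by move=> By; have : (~` C) y by rewrite -BC.
exists (SigSub (mem_set Yx)) => //.
by apply: contrapT => nC; apply: nBx; move: nC; rewrite -[~ _]/((~` C) _) -BC.
Qed.

Lemma subgroup_stabilizer (X : topologicalType) (G : set (homeo X)) (Y : set X) :
  subgroup G -> subgroup (stabilizer G Y).
Proof.
move=> [/set_mem G1 GV]; split.
  by apply/mem_set; split=> //; exact: image_id.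
move=> f g /set_mem[Gf /homeo_imageP fY] /set_mem[Gg /homeo_imageP gY].
apply/mem_set; split; first by apply/set_mem/GV; exact/mem_set.
apply/homeo_imageP => x; apply: (iff_trans (fY (homeo_inv g x))).
by apply: (iff_trans (iff_sym (gY _))); rewrite /= homeoVK.
Qed.

(** Zorn's lemma applies because a chain of nonempty closed invariant sets has a closed invariant
    intersection, which compactness keeps nonempty. *)
Lemma minimal_closed_invariant_set (X : topologicalType) (S : set (homeo X)) :
  compact [set: X] -> [set: X] !=set0 ->
  exists Y : set X, [/\ closed Y, Y <> set0, forall g, S g -> g @` Y = Y &
    forall Z, closed Z -> Z <> set0 -> (forall g, S g -> g @` Z = Z) ->
      Z `<=` Y -> Z = Y].
Proof.
move=> cptX [x0 _].
(* [Zorn_bigcup] provides maximal sets only, so it is applied to complements. *)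
pose P (U : set X) :=
  [/\ closed (~` U), ~` U <> set0 & forall g, S g -> g @` (~` U) = ~` U].
have [F FP Ftot|U [[cU U0 SU] Umax]] := @Zorn_bigcup X P.
  split.
  - by rewrite setC_bigcup; apply: closed_bigI => U /FP[].
  - have [->|/set0P[U0 FU0]] := eqVneq F set0.
      by rewrite bigcup_set0 setC0 => /seteqP[/(_ x0)/(_ I)].
    (* The complements of the members of the chain generate a proper filter. A cluster point of it
       lies in each of them, as they are closed. *)
    have FF : ProperFilter (filter_from F (fun U => ~` U)).
      apply: filter_from_proper; last by move=> U /FP[_ /eqP/set0P].
      apply: filter_from_filter; first by exists U0.
      move=> U V FU FV; have [UV|VU] := Ftot _ _ FU FV.
        by exists V => // x nVx; split=> // /UV.
      by exists U => // x nUx; split=> // /VU.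
    have [|p [_ Fp]] := cptX _ FF; first by exists U0.
    move=> /seteqP[/(_ p)+ _]; apply => -[U FU]; apply: contrapT.
    rewrite not_notE; have [cU _ _] := FP _ FU.
    by apply: cU => B Bp; apply: Fp => //; exists U.
  - move=> g Sg; apply/homeo_imageP => x.
    have gF U : F U -> (~` U) (g x) <-> (~` U) x.
      by move=> /FP[_ _ /(_ g Sg)/homeo_imageP].
    by rewrite setC_bigcup; split=> nF U FU; apply/(gF U FU)/nF.
exists (~` U); split=> // Z cZ Z0 SZ ZU; apply: contrapT => ZnU.
apply: (Umax (~` Z)); last by rewrite /P setCK.
split; first by move=> x Ux /ZU.
move=> nE; apply: ZnU; apply/seteqP; split=> // x nUx.
by apply: contrapT => /nE.
Qed.

Theorem theorem1p1 (R : realType) (X : topologicalType)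
    (X_tdisc : totally_disconnected [set: X])
    (X_compact : compact [set: X])
    (X_metrizable : metrizable R X)
    (G : set (homeo X))
    (G_group : subgroup G)
    (G_ample : ample G)
    (G_minimal : acts_minimally G)
    (H : set (homeo X))
    (H_maximal : maximal_subgroup H G)
    (H_not_minimal : ~ acts_minimally H) :
  exists Y : set X,
    [/\ closed Y, Y <> set0, Y <> [set: X], H = stabilizer G Y &
        acts_minimally (induced_action (stabilizer G Y) Y)].
Proof.
(* On an empty space every action is minimal. *)
have X0 : [set: X] !=set0.
  apply: contrapT => /set0P/negP; rewrite negbK => /eqP X0.
  by apply: H_not_minimal => C _ _; left; rewrite -subset0 -X0.
have [Y [cY Y0 HY Ymin]] := minimal_closed_invariant_set X H X_compact X0.
have YT : Y <> [set: X].
  (* If [Y] were all of [X], its minimality would say that [H] acts minimally. *)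
  move=> YT; apply: H_not_minimal => C cC HC.
  have [C0|/eqP C0] := eqVneq C set0; [by left|right].
  by rewrite -YT; apply: Ymin => //; rewrite YT.
have [H_group [HG _] H_max] := H_maximal.
have HE : H = stabilizer G Y.
  apply: contrapT => HnE; apply: H_max; exists (stabilizer G Y).
  have HS : H `<=` stabilizer G Y by move=> g Hg; split; [exact: HG|exact: HY].
  split; first exact: subgroup_stabilizer.
    by split=> // SH; apply: HnE; apply/seteqP.
  split=> [g []//|GS].
  by have [] := G_minimal Y cY (fun g Gg => (GS g Gg).2).
exists Y; split=> // C cC SC.
have [C0|/eqP C0] := eqVneq C set0; [by left|right].
have ZE : set_val @` C = Y.
  apply: Ymin.
  - exact: closed_set_val_image.
  - by move/image_set0_set0.
  - move=> g Hg; have [h hE] := homeo_restrict X g Y (HY g Hg).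
    have hC : h @` C = C by apply: SC; exists g => //; rewrite -HE.
    (* Rewriting only the right-hand side makes both sides images of [C], under [g] after [set_val]
       and under [set_val] after [h]; these maps agree by [hE]. *)
    have {2}<- : set_val @` (h @` C) = set_val @` C by rewrite hC.
    by rewrite !image_comp; apply: eq_imagel => y _ /=; rewrite -hE.
  - by move=> _ [y _ <-]; exact/set_mem/valP.
apply/seteqP; split=> // y _.
have : Y (\val y) by exact/set_mem/valP.
by rewrite -{1}ZE => -[z Cz /val_inj <-].
Qed.
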